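(* Fix $a>0$ and an integer $r$ such that $1\le r\le m_1\wedge m_2$ and $Mr\le n$, where $M=m_1\vee m_2$. Let the matrices $X_i$, $i=1,\dots,n$, be i.i.d. with distribution $\Pi$ on $\mathcal X=\{e_j(m_1)e_k^\top(m_2):1\le j\le m_1,1\le k\le m_2\}$, where $\Pi$ satisfies, for some constants $0<c_1\le c_1'<\infty$, $$\sqrt{\frac{c_1}{m_1m_2}}\le\kappa_1(\Pi)\le\kappa_1'(\Pi)\le\sqrt{\frac{c_1'}{m_1m_2}}.$$ Let $Y_i=\mathrm{tr}(X_i^\top A_0)+\xi_i$, where the $\xi_i$, $i=1,\dots,n$, are independent Gaussian $\mathcal N(0,\sigma^2)$ variables, $\sigma^2>0$, independent of $(X_1,\dots,X_n)$. Then there exist absolute constants $\beta\in(0,1)$ and $c>0$ such that $$\inf_{\hat A}\ \sup_{A_0\in\mathcal A(r,a)}\mathbb P_{A_0}\Big(\|\hat A-A_0\|_\infty>c(\sigma\wedge a)\sqrt{m_1m_2}\sqrt{\frac{M}{n}}\Big)\ge\beta.$$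
   Context: $e_k(m)$ denotes the $k$-th canonical basis vector of $\mathbb R^m$; $x\vee y=\max(x,y)$, $x\wedge y=\min(x,y)$. $\|\cdot\|_2$ and $\|\cdot\|_\infty$ are the Frobenius and spectral norm, respectively, and $\langle A,B\rangle=\mathrm{tr}(A^\top B)$. With $X\sim\Pi$, $\|A\|_{L_2(\Pi)}^2=\mathbb E(\langle A,X\rangle^2)$; $\kappa_1(\Pi)$ and $\kappa_1'(\Pi)$ are respectively the infimum and the supremum of $\|B\|_{L_2(\Pi)}$ over $B\in\mathbb R^{m_1\times m_2}$ with $\|B\|_2=1$ and $\mathrm{rank}(B)\le 1$. $\inf_{\hat A}$ is the infimum over all estimators (measurable functions of the observations $(X_1,Y_1,\dots,X_n,Y_n)$) with values in $\mathbb R^{m_1\times m_2}$. The class of matrices is $$\mathcal A(r,a)=\{A_0=(a_0(i,j))\in\mathbb R^{m_1\times m_2}:\ \mathrm{rank}(A_0)\le r,\ \max_{i,j}|a_0(i,j)|\le a\}.$$ For $A\in\mathbb R^{m_1\times m_2}$, $\mathbb P_A$ denotes the probability distribution of $(X_1,Y_1,\dots,X_n,Y_n)$ when $Y_i=\langle A,X_i\rangle+\xi_i$, so that $\mathbb E(Y_i|X_i)=\langle A,X_i\rangle$. *)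

(* Defs.v *)
From HB Require Import structures.
From mathcomp Require Import all_boot all_order all_algebra.
From mathcomp Require Import all_classical all_reals all_analysis.

Set Implicit Arguments.
Unset Strict Implicit.
Unset Printing Implicit Defensive.

Import Order.TTheory GRing.Theory Num.Theory.
Import numFieldNormedType.Exports.

Local Open Scope classical_set_scope.
Local Open Scope ring_scope.

(* Borel sigma-algebra on matrices. *)
HB.instance Definition _ (R : realType) (m n : nat) :=
  @isMeasurable.Build (sigma_display (@open 'M[R]_(m, n)))
    'M[R]_(m, n) <<s @open 'M[R]_(m, n) >>
    (@sigma_algebra0 _ setT open) (@sigma_algebraC _ open)
    (@sigma_algebra_bigcup _ setT open).

Section matrices.
Context {R : realType}.

Definition mxdot (m n : nat) (A B : 'M[R]_(m, n)) : R := \tr (A^T *m B).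

(* On column vectors ('cV_m = 'M_(m, 1)) this is the Euclidean norm. *)
Definition frob_norm (m n : nat) (A : 'M[R]_(m, n)) : R :=
  Num.sqrt (mxdot A A).

(* The supremum of a nonempty bounded set when 0 < n; [sup] returns 0 on the
   empty set, so that the norm is 0 when n = 0. *)
Definition spectral_norm (m n : nat) (A : 'M[R]_(m, n)) : R :=
  sup [set frob_norm (A *m x) | x in [set x : 'cV[R]_n | frob_norm x = 1]].

Definition basis_vec (m : nat) (k : 'I_m) : 'cV[R]_m := delta_mx k 0.

Definition basis_mxs (m1 m2 : nat) : set 'M[R]_(m1, m2) :=
  [set X | exists (j : 'I_m1) (k : 'I_m2),
     X = basis_vec j *m (basis_vec k)^T].

Definition mx_class (m1 m2 r : nat) (a : R) : set 'M[R]_(m1, m2) :=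
  [set A | (\rank A <= r)%N /\ forall i j, `|A i j| <= a].

Definition unit_rank1 (m1 m2 : nat) : set 'M[R]_(m1, m2) :=
  [set B | frob_norm B = 1 /\ (\rank B <= 1)%N].

Definition L2Pi (m1 m2 : nat) (Pi : probability 'M[R]_(m1, m2) R)
    (A : 'M[R]_(m1, m2)) : \bar R :=
  ('N[Pi]_2%:E[(fun X => (mxdot A X)%:E)])%E.

Definition kappa1 (m1 m2 : nat) (Pi : probability 'M[R]_(m1, m2) R) : \bar R :=
  ereal_inf (L2Pi Pi @` @unit_rank1 m1 m2).

Definition kappa1' (m1 m2 : nat) (Pi : probability 'M[R]_(m1, m2) R) : \bar R :=
  ereal_sup (L2Pi Pi @` @unit_rank1 m1 m2).

End matrices.

Section laws.
Context {R : realType} {d : measure_display} {Omega : measurableType d}.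
Variable P : probability Omega R.

(* Equality of set functions is only required on measurable sets: the values
   of a measure outside its sigma-algebra are unspecified. *)
Definition has_law {d'} {T : measurableType d'} (X : Omega -> T)
    (mu : set T -> \bar R) : Prop :=
  forall A : set T, measurable A -> pushforward P X A = mu A.

(* Some of the A i may be the full set, so this gives the product rule for
   every subfamily. *)
Definition mutually_independent {d'} {T : measurableType d'} (n : nat)
    (X : 'I_n -> Omega -> T) : Prop :=
  forall A : 'I_n -> set T, (forall i, measurable (A i)) ->
    P [set w | forall i, A i (X i w)] =
    (\prod_(i < n) P (X i @^-1` A i))%E.

Definition independent {d1 d2} {T1 : measurableType d1}
    {T2 : measurableType d2} (X : Omega -> T1) (Y : Omega -> T2) : Prop :=
  forall (A : set T1) (B : set T2), measurable A -> measurable B ->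
    P (X @^-1` A `&` Y @^-1` B) = (P (X @^-1` A) * P (Y @^-1` B))%E.

Definition vec {T : Type} (n : nat) (X : 'I_n -> Omega -> T)
    (w : Omega) : n.-tuple T :=
  [tuple X i w | i < n].

Context {m1 m2 n : nat}.

Definition observations (X : 'I_n -> Omega -> 'M[R]_(m1, m2))
    (xi : 'I_n -> Omega -> R) (A : 'M[R]_(m1, m2)) :
    Omega -> n.-tuple ('M[R]_(m1, m2) * R)%type :=
  vec (fun i w => (X i w, mxdot (X i w) A + xi i w)).

(* P_A, the law of (X_1, Y_1, ..., X_n, Y_n) under the parameter A. *)
Definition obs_law (X : 'I_n -> Omega -> 'M[R]_(m1, m2))
    (xi : 'I_n -> Omega -> R) (A : 'M[R]_(m1, m2)) :
    set (n.-tuple ('M[R]_(m1, m2) * R)%type) -> \bar R :=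
  pushforward P (observations X xi A).

End laws.

(* Main.v *)
(* Only rank-one parameters with constant rows (or columns) are needed.  For
   m1 >= m2 put M = m1 and let A_u = u 1^T, where u ranges over the sign vectors
   {-delta, delta}^M with delta = (sigma /\ a) sqrt(M / n) / 4; as M <= n, these
   entries are at most a.  Conditionally on X_1, ..., X_n, the coordinate u_j is
   seen through the N_j observations falling in row j, and sum_j N_j = n.
   Flipping u_j shifts N_j independent Gaussians by 2 delta, so the two errors of any test of the sign of
   u_j add up to at least 3/4 - t_j with t_j = 4 delta^2 N_j / sigma^2 and
   sum_j t_j <= M / 4.  Averaging over u (Assouad), an estimator makes at least
   M / 4 sign errors in expectation, hence more than M / 8 of them with
   probability at least 1/8 for some u.  The signs tested are those of the row
   sums of the estimator, and applying Ahat - A_u to the vector 1 shows that k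
   sign errors force a squared spectral norm of at least k m2 delta^2. *)

Require Import Defs.
From HB Require Import structures.
From mathcomp Require Import all_boot all_order all_algebra.
From mathcomp Require Import all_classical all_reals all_analysis.
From mathcomp Require Import measurable_realfun ring lra.
From mathcomp Require finmap.

Set Implicit Arguments.
Unset Strict Implicit.
Unset Printing Implicit Defensive.

Import Order.TTheory GRing.Theory Num.Theory.
Import numFieldNormedType.Exports.

Local Open Scope classical_set_scope.
Local Open Scope ring_scope.

Local Notation push_measure :=
  measure_function_pushforward__canonical__measure_function_Measure.

(** * Measures with a density *)

Section density.
Local Open Scope ereal_scope.
Context d (T : measurableType d) (R : realType).

Import HBNNSimple.

(** Both sides pass to the monotone limit along simple functions increasing to [f]. Linearity then
    reduces the identity to indicators, where it is the hypothesis on [m]. *)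
Lemma ge0_integral_density (m mu : {measure set T -> \bar R}) (g : T -> R) :
  measurable_fun setT g -> (forall x, 0 <= g x)%R ->
  (forall A, measurable A -> m A = \int[mu]_(x in A) (g x)%:E) ->
  forall (D : set T) (f : T -> \bar R), measurable D -> measurable_fun setT f ->
  (forall x, 0 <= f x) ->
  \int[m]_(x in D) f x = \int[mu]_(x in D) (f x * (g x)%:E).
Proof.
move=> mg g0 mE D f mD mfT f0.
have mf : measurable_fun D f by exact: measurable_funTS.
have mgE : measurable_fun D (fun x => (g x)%:E).
  by apply/measurable_EFinP; exact: measurable_funTS.
pose h := nnsfun_approx mD mf.
have -> : \int[m]_(x in D) f x =
    limn (fun n => \int[m]_(x in D) (EFin \o h n) x).
  have fE x : D x -> f x = limn (fun n => (EFin \o h n) x).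
    by move=> Ex; apply/esym/cvg_lim => //; exact: cvg_nnsfun_approx.
  under eq_integral => x /[!inE] /fE -> //.
  apply: monotone_convergence => //.
  - by move=> n; apply/measurable_EFinP/measurable_funTS.
  - by move=> n x Ex //=; rewrite lee_fin.
  - by move=> x Ex a b ab; rewrite lee_fin; exact/lefP/nd_nnsfun_approx.
have -> : \int[mu]_(x in D) (f x * (g x)%:E) =
    limn (fun n => \int[mu]_(x in D) ((EFin \o h n) x * (g x)%:E)).
  have fg x : D x -> f x * (g x)%:E = limn (fun n => (EFin \o h n) x * (g x)%:E).
    by move=> Ex; apply/esym/cvg_lim => //; apply: cvgeZr => //;
      exact: cvg_nnsfun_approx.
  under eq_integral => x /[!inE] /fg -> //.
  apply: monotone_convergence => [//| | |].
  - move=> n; apply: emeasurable_funM => //.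
    by apply/measurable_EFinP/measurable_funTS.
  - by move=> n x Ex /=; rewrite mule_ge0 ?lee_fin.
  - by move=> x Ex a b ab/=; rewrite lee_wpmul2r ?lee_fin//; exact/lefP/nd_nnsfun_approx.
suff suf n : \int[mu]_(x in D) ((EFin \o h n) x * (g x)%:E) =
    \int[m]_(x in D) (EFin \o h n) x.
  by under [in RHS]eq_fun do rewrite suf.
transitivity (\int[m]_(x in D)
   (\sum_(y \in range (h n)) (y * \1_(h n @^-1` [set y]) x)%:E)); last first.
  by apply: eq_integral => t tE; rewrite /= fimfunE -fsumEFin.
have indich r : measurable_fun D (fun x => (r * \1_(h n @^-1` [set r]) x)%:E).
  by apply: (measurable_comp measurableT) => //; exact: measurable_funM.
rewrite ge0_integral_fsum//; last by move=> k y Ey; exact: nnfun_muleindic_ge0.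
transitivity (\int[mu]_(x in D) (\sum_(y \in range (h n))
    (y * \1_(h n @^-1` [set y]) x)%:E * (g x)%:E)).
  under [RHS]eq_integral => x xE.
    rewrite -ge0_mule_fsuml => [|y]; last exact: nnfun_muleindic_ge0.
    rewrite fsumEFin // -(fimfunE _ x); over.
  by [].
rewrite ge0_integral_fsum//; last 2 first.
  - by move=> y; apply: emeasurable_funM.
  - by move=> k y Ey; rewrite mule_ge0 ?nnfun_muleindic_ge0 ?lee_fin.
apply: eq_fsbigr => r rhn.
under [RHS]eq_integral do rewrite EFinM.
rewrite integralZl_indic_nnsfun => //.
under eq_integral do rewrite EFinM -muleA.
rewrite ge0_integralZl//.
- under eq_integral do rewrite muleC.
  rewrite (eq_integral ((fun x => (g x)%:E) \_ (h n @^-1` [set r]))); last first.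
    by move=> x xE; rewrite epatch_indic.
  have mDr : measurable (D `&` h n @^-1` [set r]) by exact: measurableI.
  by rewrite -integral_mkcondr -mE// integral_indic// setIC.
- apply: emeasurable_funM => //; exact/measurable_EFinP.
- by move=> t Et; rewrite mule_ge0 ?lee_fin.
- by move: rhn; rewrite inE => -[t _ <-]; rewrite lee_fin.
Qed.

(** Restriction to [A] is the case of the density [\1_A]. *)
Lemma integral_mrestr (mu : {measure set T -> \bar R}) (A D : set T)
    (mA : measurable A) (f : T -> \bar R) :
  measurable D -> measurable_fun setT f -> (forall x, 0 <= f x) ->
  \int[mrestr mu mA]_(x in D) f x = \int[mu]_(x in D `&` A) f x.
Proof.
move=> mD mf f0.
have mE B : measurable B -> mrestr mu mA B = \int[mu]_(x in B) (\1_A x)%:E.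
  by move=> mB; rewrite /mrestr integral_indic// setIC.
rewrite (ge0_integral_density _ _ mE)//.
by rewrite integral_mkcondr; apply: eq_integral => x _; rewrite epatch_indic.
Qed.

(** The properties of [g] are arguments so that the measure structure below attaches to the term
    itself. *)
Definition density_measure (mu : {measure set T -> \bar R}) (g : T -> R)
  (mg : measurable_fun setT g) (g0 : forall x, (0 <= g x)%R) (A : set T) : \bar R :=
  \int[mu]_(x in A) (g x)%:E.

Section density_measure.
Variables (mu : {measure set T -> \bar R}) (g : T -> R).
Hypotheses (mg : measurable_fun setT g) (g0 : forall x, (0 <= g x)%R).
Local Notation dm := (density_measure mu mg g0).

Let dm0 : dm set0 = 0.
Proof. by rewrite /density_measure integral_set0. Qed.

Let dm_ge0 A : 0 <= dm A.
Proof. by apply: integral_ge0 => x _; rewrite lee_fin. Qed.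

Let dm_sigma_additive : semi_sigma_additive dm.
Proof.
move=> F mF tF mUF; rewrite /density_measure ge0_integral_bigcup//.
- by apply: is_cvg_ereal_nneg_natsum_cond => n _ _; exact: dm_ge0.
- by apply/measurable_EFinP; exact: measurable_funTS.
- by move=> x _; rewrite lee_fin.
Qed.

HB.instance Definition _ := isMeasure.Build _ _ _ dm dm0 dm_ge0 dm_sigma_additive.
End density_measure.
End density.

(** * Shifts of Gaussian vectors *)

Section gaussian_shift.
Context {R : realType}.
Implicit Types (s h y : R).
Local Notation leb := (@lebesgue_measure R).

Let shiftR h : measurableTypeR R -> measurableTypeR R := fun y => y + h.

Let measurable_shiftR h : measurable_fun setT (shiftR h).
Proof. exact: measurable_funD. Qed.

(** Lebesgue measure is determined by its values on half-open intervals, whose length a translation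
    preserves. *)
Lemma lebesgue_measure_shift h (A : set (measurableTypeR R)) : measurable A ->
  pushforward leb (fun y : measurableTypeR R => (y + h : measurableTypeR R)) A = leb A.
Proof.
move=> mA.
pose mu := push_measure leb (measurable_shiftR h).
suff: forall X, ocitv X -> leb X = mu X by move=> /lebesgue_measure_unique ->.
move=> _ [[a b]] _ <- /=.
rewrite /pushforward (_ : _ @^-1` _ = `]a - h, b - h]%classic); last first.
  by apply/seteqP; split=> y /=; rewrite !in_itv/= ltrBlDr lerBrDr.
rewrite !lebesgue_measure_itv/= !lte_fin ltrD2r -!EFinB.
by case: ifP => // _; congr EFin; ring.
Qed.

(** The likelihood ratio of N(h, s^2) against N(0, s^2). *)
Definition gauss_lr s h y : R := expR ((h * y *+ 2 - h ^+ 2) / (s ^+ 2 *+ 2)).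

Lemma gauss_lr_ge0 s h y : 0 <= gauss_lr s h y.
Proof. exact: expR_ge0. Qed.

Lemma measurable_gauss_lr s h : measurable_fun [set: R] (gauss_lr s h).
Proof.
apply: measurableT_comp => //; apply: measurable_funM => //.
apply: measurable_funB => //.
under eq_fun do rewrite -mulr_natr.
by apply: measurable_funM => //; exact: measurable_funM.
Qed.

(** Used coordinatewise, this turns the second moment of a product of likelihood ratios into a first
    moment for the doubled shift. *)
Lemma gauss_lr_sqr s h y : s != 0 ->
  gauss_lr s h y ^+ 2 = expR (h ^+ 2 / s ^+ 2) * gauss_lr s (h *+ 2) y.
Proof.
by move=> s0; rewrite /gauss_lr -expRM_natl -expRD; congr expR; field.
Qed.

Lemma normal_pdf_gauss_lr s h y : s != 0 ->
  normal_pdf 0 s y * gauss_lr s h y = normal_pdf h s y.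
Proof.
move=> s0; rewrite !normal_pdfE// -mulrA; congr (_ * _).
by rewrite /normal_fun -expRD; congr expR; field.
Qed.

(** Translation invariance of Lebesgue measure: the centred density at [y] equals the density of
    mean [h] at [y + h]. *)
Let normal_prob_shift0 s h (A : set R) : s != 0 -> measurable A ->
  normal_prob 0 s ((fun y => y + h) @^-1` A) =
  (\int[normal_prob 0 s]_(y in A) (gauss_lr s h y)%:E)%E.
Proof.
move=> s0 mA.
have mpdf m : measurable_fun [set: R] (normal_pdf m s).
  exact: measurable_normal_pdf.
rewrite (@ge0_integral_density _ _ R (normal_prob 0 s) leb _ (mpdf 0))//; last 3 first.
- by move=> x; exact: normal_pdf_ge0.
- by apply/measurable_EFinP; exact: measurable_gauss_lr.
- by move=> x; rewrite lee_fin gauss_lr_ge0.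
under eq_integral do rewrite -EFinM mulrC normal_pdf_gauss_lr//.
transitivity (\int[pushforward leb (shiftR h)]_(y in A) (normal_pdf h s y)%:E)%E;
  last first.
  apply: (@eq_measure_integral _ _ _ _ leb (push_measure leb (measurable_shiftR h))).
  by move=> B mB _; exact: lebesgue_measure_shift.
rewrite (ge0_integral_pushforward (measurable_shiftR h))//=; last 2 first.
- apply: measurable_funTS; apply/measurable_EFinP. exact: mpdf.
- by move=> y _; rewrite lee_fin; exact: normal_pdf_ge0.
apply: eq_integral => y _ /=; rewrite !normal_pdfE// /normal_fun.
by rewrite subr0 addrK.
Qed.

(* The library puts [normal_prob] on [measurableTypeR R], whose display differs
   from that of [R] itself; [nu] is its copy on [R]. *)
Lemma normal_prob_shift s h (nu : probability R R) (A : set R) :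
  (forall B, measurable B -> nu B = normal_prob 0 s B) ->
  s != 0 -> measurable A ->
  nu ((fun y => y + h) @^-1` A) = (\int[nu]_(y in A) (gauss_lr s h y)%:E)%E.
Proof.
move=> nuE s0 mA.
have mh : measurable_fun setT (fun y : R => y + h) by exact: measurable_funD.
rewrite nuE; last by rewrite -[X in measurable X]setTI; exact: mh.
rewrite normal_prob_shift0//.
have mid : measurable_fun [set: measurableTypeR R] (fun y : measurableTypeR R => (y : R)).
  exact: measurable_id.
rewrite [RHS](@eq_measure_integral _ _ _ _
  (push_measure (normal_prob 0 s) mid) nu); last first.
  by move=> B mB _; exact: nuE.
rewrite (ge0_integral_pushforward mid (normal_prob 0 s) mA)//.
- apply: measurable_funTS; apply/measurable_EFinP.
  exact: measurable_gauss_lr.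
- by move=> y _; rewrite lee_fin gauss_lr_ge0.
Qed.

End gaussian_shift.

(** * Rectangles as a generating pi-system of the product sigma-algebra *)

Section tuple_rectangles.
Context d (T : measurableType d) (n : nat).

Definition rectangles : set (set (n.-tuple T)) :=
  [set B | exists2 A : 'I_n -> set T, (forall i, measurable (A i)) &
     B = [set y | forall i, A i (tnth y i)]].

Lemma measurable_rectangle (A : 'I_n -> set T) : (forall i, measurable (A i)) ->
  measurable [set y : n.-tuple T | forall i, A i (tnth y i)].
Proof.
move=> mA; rewrite (_ : [set _ | _] =
    \bigcap_(i in [set: 'I_n]) ((@tnth n T ^~ i) @^-1` A i)).
  apply: fin_bigcap_measurable => // i _.
  by rewrite -[X in measurable X]setTI; apply: (measurable_tnth i).
by apply/seteqP; split=> [y yA i _|y yA i]; exact: yA.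
Qed.

Lemma setI_closed_rectangles : setI_closed rectangles.
Proof.
move=> _ _ [A mA ->] [B mB ->]; exists (fun i => A i `&` B i).
  by move=> i; exact: measurableI.
apply/seteqP; split=> [y [yA yB] i|y yAB]; first by split.
by split=> i; have [] := yAB i.
Qed.

(** The preimages under coordinates generate the sigma-algebra, and each is a rectangle whose other
    sides are full. *)
Lemma measurable_rectanglesE : measurable = <<s rectangles >>.
Proof.
apply/seteqP; split; last first.
  apply: smallest_sub; first exact: sigma_algebra_measurable.
  by move=> _ [A mA ->]; exact: measurable_rectangle.
apply: smallest_sub; first exact: smallest_sigma_algebra.
rewrite -bigcup_seq => B [/= i _ [A mA <-]]; apply: sub_sigma_algebra.
exists (fun j => if j == i then A else setT) => [j|]; first by case: ifP.
rewrite setTI; apply/seteqP; split=> y /= => [yA j|/(_ i)]; last by rewrite eqxx.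
by case: eqP => // ->.
Qed.

(** Rectangles are stable under intersection, generate the sigma-algebra and include the whole
    space, which serves as a constant exhausting sequence since [mu] is finite. *)
Lemma rectangle_measure_unique (R : realType)
    (mu nu : {measure set (n.-tuple T) -> \bar R}) :
  (mu setT < +oo)%E ->
  (forall A : 'I_n -> set T, (forall i, measurable (A i)) ->
     mu [set y | forall i, A i (tnth y i)] = nu [set y | forall i, A i (tnth y i)]) ->
  forall B, measurable B -> mu B = nu B.
Proof.
move=> muoo munu B mB.
apply: (measure_unique rectangles (fun=> setT)) => //.
- exact: measurable_rectanglesE.
- exact: setI_closed_rectangles.
- by move=> _; exists (fun=> setT) => //; apply/seteqP; split.
- by apply/seteqP; split=> // y _; exists 0%N.
- by move=> _ [A mA ->]; exact: munu.
Qed.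

End tuple_rectangles.

(** * Translating one coordinate of a Gaussian product *)

Section shift_tuple.
Context {R : realType} (n : nat) (s : R).
Hypothesis s0 : s != 0.
Variable nu : probability R R.
Hypothesis nuE : forall B, measurable B -> nu B = normal_prob 0 s B.
Variable mu : probability (n.-tuple R) R.
(** The n-fold power of [nu] is given by its values on rectangles, the form in which independence of
    the noise provides it. *)
Hypothesis mu_rect : forall A : 'I_n -> set R, (forall i, measurable (A i)) ->
  mu [set y | forall i, A i (tnth y i)] = (\prod_(i < n) nu (A i))%E.

Definition tshift (h : 'I_n -> R) (y : n.-tuple R) : n.-tuple R :=
  [tuple tnth y i + h i | i < n].

Lemma measurable_tshift h : measurable_fun setT (tshift h).
Proof.
apply/measurable_fun_tnthP => i /=.
under [X in measurable_fun _ X]eq_fun do rewrite tnth_mktuple.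
by apply: measurable_funD => //; exact: measurable_tnth.
Qed.

Lemma tshiftD h k y : tshift h (tshift k y) = tshift (fun i => k i + h i) y.
Proof. by apply: eq_from_tnth => i; rewrite !tnth_mktuple addrA. Qed.

Let single (i : 'I_n) (h : R) (j : 'I_n) : R := if j == i then h else 0.

Let mcoord_lr i h : measurable_fun setT (fun y : n.-tuple R => gauss_lr s h (tnth y i)).
Proof.
by apply: measurableT_comp; [exact: measurable_gauss_lr|exact: measurable_tnth].
Qed.

(** The translation affects only the [i]-th side of a rectangle. The other sides factor out as the
    constant [c], which leaves the one-dimensional [normal_prob_shift]. *)
Let coord_shift_rect i h (A : 'I_n -> set R) : (forall j, measurable (A j)) ->
  mu (tshift (single i h) @^-1` [set y | forall j, A j (tnth y j)]) =
  (\int[mu]_(y in [set y | forall j, A j (tnth y j)]) (gauss_lr s h (tnth y i))%:E)%E.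
Proof.
move=> mA.
pose A' C j := if j == i then C else A j.
have mA' C : measurable C -> forall j, measurable (A' C j).
  by move=> mC j; rewrite /A'; case: ifP.
pose c := fine (\prod_(j < n | j != i) nu (A j))%E.
have cE : (\prod_(j < n | j != i) nu (A j))%E = c%:E.
  rewrite fineK//; elim/big_ind: _ => //; first by move=> x y ? ?; rewrite fin_numM.
  by move=> j ji; apply: fin_num_measure.
have c0 : 0 <= c by rewrite fine_ge0//; apply: prode_ge0 => j _; exact: measure_ge0.
have muA' C : measurable C ->
    mu [set y | forall j, A' C j (tnth y j)] = (c%:E * nu C)%E.
  move=> mC; rewrite mu_rect; last exact: mA'.
  rewrite (bigD1 i)//= {1}/A' eqxx muleC -cE; congr (_ * _)%E.
  by apply: eq_bigr => j ji; rewrite /A' (negbTE ji).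
have mshA : measurable ((fun y => y + h) @^-1` A i).
  have mh : measurable_fun setT (fun y : R => y + h) by exact: measurable_funD.
  by rewrite -[X in measurable X]setTI; exact: mh.
transitivity (mu [set y | forall j, A' ((fun y => y + h) @^-1` A i) j (tnth y j)]).
  congr (mu _); apply/seteqP; split=> y /= yA j; move: (yA j);
    rewrite tnth_mktuple /single /A'; case: eqP => [->|_] //; rewrite addr0//.
rewrite muA'// (normal_prob_shift h nuE s0)//.
pose D := [set y : n.-tuple R | forall j, A' setT j (tnth y j)].
have mD : measurable D.
  by apply: measurable_rectangle => j; apply: mA'; exact: measurableT.
pose E := (@tnth n R ^~ i) @^-1` A i.
have mE : measurable E.
  by rewrite -[X in measurable X]setTI; apply: (measurable_tnth i).
have -> : [set y : n.-tuple R | forall j, A j (tnth y j)] = E `&` D.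
  apply/seteqP; split=> [y yA|y [yE yD] j].
    by split; [exact: yA|move=> j; rewrite /A'; case: ifP => // _; exact: yA].
  by have := yD j; rewrite /A'; case: eqP => [->|].
rewrite -(integral_mrestr mu mD)//; last 2 first.
- by apply/measurable_EFinP; exact: mcoord_lr.
- by move=> y; rewrite lee_fin gauss_lr_ge0.
pose f (x : R) := (gauss_lr s h x)%:E.
have mf : measurable_fun setT f by apply/measurable_EFinP; exact: measurable_gauss_lr.
have f0 x : (0 <= f x)%E by rewrite lee_fin gauss_lr_ge0.
have mf' : measurable_fun (A i) f by exact: measurable_funTS.
(* The integrand depends on coordinate [i] alone, and the image under this coordinate of [mu]
   restricted to [D], the rectangle with its [i]-th side freed, is [c] times [nu]. *)
have := ge0_integral_pushforward (@measurable_tnth _ R n i) (mrestr mu mD)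
  (mA i) mf' (fun x _ => f0 x).
rewrite /comp /= -/E => <-.
rewrite -(@ge0_integral_mscale _ _ _ nu _ (mA i) (NngNum c0) f mf')//.
apply/esym.
pose m1 := push_measure (mrestr mu mD) (@measurable_tnth _ R n i).
pose m2 : {measure set R -> \bar R} := mscale (NngNum c0) nu.
apply: (@eq_measure_integral _ _ _ _ m2 m1).
move=> C mC _; rewrite /= /pushforward /mrestr /mscale/= -muA'//.
congr (mu _); apply/seteqP; split=> [y [yC yD] j|y yA].
  by have := yD j; rewrite /A'; case: eqP => [->|].
split=> [|j]; first by have := yA i; rewrite /A' eqxx.
by rewrite /A'; case: ifP => // ji; have := yA j; rewrite /A' ji.
Qed.

(** The image of [mu] under the shift and the measure with the likelihood ratio as density agree on
    rectangles, hence everywhere. *)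
Lemma integral_coord_shift (i : 'I_n) (h : R) (f : n.-tuple R -> \bar R) :
  measurable_fun setT f -> (forall y, 0 <= f y)%E ->
  (\int[mu]_y f (tshift (fun j => (if j == i then h else 0)%R) y) =
   \int[mu]_y (f y * (gauss_lr s h (tnth y i))%:E))%E.
Proof.
move=> mf f0; rewrite -/(single i h).
have g0 (y : n.-tuple R) : 0 <= gauss_lr s h (tnth y i) by exact: gauss_lr_ge0.
pose rho : {measure set (n.-tuple R) -> \bar R} := density_measure mu (mcoord_lr i h) g0.
pose pm := push_measure mu (measurable_tshift (single i h)).
have := ge0_integral_pushforward (measurable_tshift (single i h)) mu
  measurableT mf (fun y _ => f0 y).
rewrite preimage_setT /comp => <-.
rewrite -(@ge0_integral_density _ _ _ rho mu _ (mcoord_lr i h))//.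
apply: (@eq_measure_integral _ _ _ _ rho pm) => B mB _.
apply: (@rectangle_measure_unique _ _ _ _ pm rho) => //.
- by rewrite /= /pushforward preimage_setT probability_setT ltry.
- by move=> A mA; exact: coord_shift_rect.
Qed.

End shift_tuple.

(** * Testing a Gaussian product against its translate *)

Section shift_test.
Context {R : realType} (n : nat) (s : R).
Hypothesis s0 : s != 0.
Variable nu : probability R R.
Hypothesis nuE : forall B, measurable B -> nu B = normal_prob 0 s B.
Variable mu : probability (n.-tuple R) R.
Hypothesis mu_rect : forall A : 'I_n -> set R, (forall i, measurable (A i)) ->
  mu [set y | forall i, A i (tnth y i)] = (\prod_(i < n) nu (A i))%E.

Definition tuple_lr (h : 'I_n -> R) (y : n.-tuple R) : R :=
  \prod_(i < n) gauss_lr s (h i) (tnth y i).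

Lemma tuple_lr_ge0 h y : 0 <= tuple_lr h y.
Proof. by apply: prodr_ge0 => i _; exact: gauss_lr_ge0. Qed.

Lemma measurable_tuple_lr h : measurable_fun setT (tuple_lr h).
Proof.
apply: measurable_prod => i _.
by apply: measurableT_comp; [exact: measurable_gauss_lr|exact: measurable_tnth].
Qed.

Lemma tuple_lr_sqr h y :
  tuple_lr h y ^+ 2 =
  expR (\sum_(i < n) h i ^+ 2 / s ^+ 2) * tuple_lr (fun i => h i *+ 2) y.
Proof.
rewrite /tuple_lr -prodrXl expR_sum -big_split/=.
by apply: eq_bigr => i _; rewrite gauss_lr_sqr.
Qed.

Lemma integral_tshift h (f : n.-tuple R -> \bar R) :
  measurable_fun setT f -> (forall y, 0 <= f y)%E ->
  (\int[mu]_y f (tshift h y) = \int[mu]_y (f y * (tuple_lr h y)%:E))%E.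
Proof.
move=> mf f0.
(* [hk k] shifts only the first [k] coordinates, so that the induction adds one coordinate at a
   time. *)
pose hk k (i : 'I_n) : R := if (i < k)%N then h i else 0.
suff /(_ n (leqnn n) f mf f0) : forall k, (k <= n)%N -> forall g : n.-tuple R -> \bar R,
    measurable_fun setT g -> (forall y, 0 <= g y)%E ->
    (\int[mu]_y g (tshift (hk k) y) =
     \int[mu]_y (g y * (\prod_(i < n | (i < k)%N) gauss_lr s (h i) (tnth y i))%:E))%E.
  rewrite (_ : hk n = h); last by apply/funext => i; rewrite /hk ltn_ord.
  move=> ->; apply: eq_integral => y _; congr (_ * (_)%:E)%E.
  by apply: eq_bigl => i; rewrite ltn_ord.
elim=> [_ g mg g0|k IHk kn g mg g0].
  apply: eq_integral => y _; rewrite big_pred0// mule1; congr g.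
  by apply: eq_from_tnth => i; rewrite tnth_mktuple /hk addr0.
pose i := Ordinal kn.
have mlr : measurable_fun setT (fun y : n.-tuple R => (gauss_lr s (h i) (tnth y i))%:E).
  apply/measurable_EFinP.
  by apply: measurableT_comp; [exact: measurable_gauss_lr|exact: measurable_tnth].
transitivity (\int[mu]_y (g \o tshift (hk k))
    (tshift (fun j => if j == i then h i else 0%R) y))%E.
  apply: eq_integral => y _ /=; rewrite tshiftD; congr (g (tshift _ _)).
  apply/funext => j; rewrite /hk ltnS leq_eqVlt -(inj_eq val_inj)/=.
  by case: eqP => [jk|_] /=; rewrite ?add0r// jk ltnn addr0; congr h; exact/val_inj.
rewrite (integral_coord_shift s0 nuE mu_rect); last 2 first.
- by apply: measurableT_comp => //; exact: measurable_tshift.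
- by move=> y; exact: g0.
(* The new factor joins the integrand before the induction hypothesis is applied; [hk k] fixes
   coordinate [k], so the shift leaves this factor unchanged. *)
pose gi (z : n.-tuple R) := (g z * (gauss_lr s (h i) (tnth z i))%:E)%E.
transitivity (\int[mu]_y gi (tshift (hk k) y))%E.
  by rewrite /gi; apply: eq_integral => y _ /=; rewrite tnth_mktuple /hk ltnn addr0.
rewrite IHk; last 3 first.
- exact: ltnW.
- exact: emeasurable_funM.
- by move=> y; rewrite mule_ge0// lee_fin gauss_lr_ge0.
apply: eq_integral => y _; rewrite /gi -muleA -EFinM; congr (_ * (_)%:E)%E.
rewrite [RHS](bigD1 i)//=; congr (_ * _); apply: eq_bigl => j.
by rewrite -(inj_eq val_inj)/= [RHS]andbC -ltn_neqAle.
Qed.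

Lemma integral_tuple_lr h : (\int[mu]_y (tuple_lr h y)%:E = 1)%E.
Proof.
have := @integral_tshift h (cst 1%E) (measurable_cst _) (fun=> lee01).
rewrite [X in X = _ -> _](_ : _ = 1%E) => [->|]; last first.
  by rewrite (integral_cst mu measurableT 1) mul1e; exact: probability_setT.
by apply: eq_integral => y _; rewrite mul1e.
Qed.

(* The pointwise bound [min 1 L >= L - L^2 / 4] replaces the total variation
   distance by the second moment of the likelihood ratio. *)
Lemma test_error_ge_expR h (B : set (n.-tuple R)) : measurable B ->
  (1 <= mu (~` B) + mu (tshift h @^-1` B) +
   (expR (\sum_(i < n) h i ^+ 2 / s ^+ 2) / 4)%:E)%E.
Proof.
move=> mB.
pose L y := tuple_lr h y.
have mL : measurable_fun setT L by exact: measurable_tuple_lr.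
have mi (A : set (n.-tuple R)) : measurable A ->
    measurable_fun setT (fun y => (\1_A y)%:E : \bar R).
  by move=> mA; apply/measurable_EFinP; exact: measurable_indic.
have mBc : measurable (~` B) by exact: measurableC.
have mTB : measurable (tshift h @^-1` B).
  by rewrite -[X in measurable X]setTI; exact: measurable_tshift.
have muE (A : set (n.-tuple R)) : measurable A -> mu A = (\int[mu]_y (\1_A y)%:E)%E.
  by move=> mA; rewrite integral_indic// setIT.
have -> : mu (tshift h @^-1` B) = (\int[mu]_y (\1_B y * L y)%:E)%E.
  under [RHS]eq_integral do rewrite EFinM.
  rewrite muE// -(@integral_tshift h (fun y => (\1_B y)%:E))//; last exact: mi.
rewrite (muE _ mBc).
set c := expR _.
(* The square of [L] is [c] times the ratio for the doubled shift, whose integral is one. *)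
have -> : (c / 4)%:E = (\int[mu]_y (L y ^+ 2 / 4)%:E)%E.
  transitivity (\int[mu]_y ((c / 4)%:E * (tuple_lr (fun i => h i *+ 2) y)%:E))%E.
    rewrite ge0_integralZl_EFin ?integral_tuple_lr ?mule1//.
    - by move=> y _; rewrite lee_fin tuple_lr_ge0.
    - by apply/measurable_EFinP; exact: measurable_tuple_lr.
    - by rewrite divr_ge0 ?expR_ge0.
  by apply: eq_integral => y _; rewrite -EFinM tuple_lr_sqr mulrAC.
have mBL : measurable_fun setT (fun y => (\1_B y * L y)%:E).
  by apply/measurable_EFinP; apply: measurable_funM => //; exact: measurable_indic.
have mL2 : measurable_fun setT (fun y => (L y ^+ 2 / 4)%:E).
  apply/measurable_EFinP; apply: measurable_funM => //.
  exact: measurable_funX.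
have L0 y : 0 <= L y by exact: tuple_lr_ge0.
have BL0 y : 0 <= \1_B y * L y by rewrite mulr_ge0.
have L20 y : 0 <= L y ^+ 2 / 4 by rewrite divr_ge0// sqr_ge0.
rewrite -ge0_integralD//; last 2 first.
- exact: mi.
- by move=> y _; rewrite lee_fin.
rewrite -ge0_integralD//; last 3 first.
- by move=> y _; rewrite -EFinD lee_fin addr_ge0.
- by apply: emeasurable_funD => //; exact: mi.
- by move=> y _; rewrite lee_fin.
rewrite -(integral_tuple_lr h); apply: ge0_le_integral => //.
- by move=> y _; rewrite lee_fin tuple_lr_ge0.
- by apply/measurable_EFinP.
- by do 2 apply: emeasurable_funD => //; exact: mi.
(* On [B] the bound is immediate; off [B] it reads [L <= 1 + L^2 / 4], that is, [0 <= (L - 2)^2]. *)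
move=> y _; rewrite -!EFinD lee_fin -/(L y) !indicE in_setC.
by case: (y \in B) => /=; have := L0 y; have := sqr_ge0 (L y - 2); nra.
Qed.

(** A bound linear in the exponent [t] can be summed over the coordinates. For [t < 3/4],
    [exp t <= 1 / (1 - t)] yields [exp t / 4 <= 1/4 + t]; for larger [t] the left side is not
    positive. *)
Lemma test_error_ge h (B : set (n.-tuple R)) : measurable B ->
  3 / 4 - \sum_(i < n) h i ^+ 2 / s ^+ 2 <=
  fine (mu (~` B)) + fine (mu (tshift h @^-1` B)).
Proof.
move=> mB.
have mTB : measurable (tshift h @^-1` B).
  by rewrite -[X in measurable X]setTI; exact: measurable_tshift.
have := test_error_ge_expR h mB.
rewrite -(@fineK _ (mu (~` B))) ?fin_num_measure//; last exact: measurableC.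
rewrite -(@fineK _ (mu (tshift h @^-1` B))) ?fin_num_measure//.
rewrite -!EFinD lee_fin.
have a0 : 0 <= fine (mu (~` B)) by rewrite fine_ge0.
have b0 : 0 <= fine (mu (tshift h @^-1` B)) by rewrite fine_ge0.
have t0 : 0 <= \sum_(i < n) h i ^+ 2 / s ^+ 2.
  by apply: sumr_ge0 => i _; rewrite divr_ge0 ?sqr_ge0.
move: (\sum_(i < n) _) t0 => t t0 h1.
have [t34|t34] := lerP (3 / 4) t; first by lra.
have : expR t * (1 - t) <= 1.
  rewrite -[leRHS](expRxMexpNx_1 t) ler_wpM2l ?expR_ge0//.
  exact: (expR_ge1Dx (- t)).
by have := expR_gt0 t; nra.
Qed.

End shift_test.

(** * Assouad's argument *)

Section assouad.
Context {R : realType} (n : nat) (s : R).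
Hypothesis s0 : s != 0.
Variable nu : probability R R.
Hypothesis nuE : forall B, measurable B -> nu B = normal_prob 0 s B.
Variable mu : probability (n.-tuple R) R.
Hypothesis mu_rect : forall A : 'I_n -> set R, (forall i, measurable (A i)) ->
  mu [set y | forall i, A i (tnth y i)] = (\prod_(i < n) nu (A i))%E.
Context (m : nat) (rho : 'I_n -> 'I_m) (delta : R).

(** Observation [i] carries information on the sign of index [rho i] only; in the regression model
    this index is a row or a column. *)
Definition signal (u : {ffun 'I_m -> bool}) (i : 'I_n) : R :=
  if u (rho i) then delta else - delta.

(** [S j] is the set of samples on which sign [j] is declared positive. The event is expressed in
    the noise [z], so that every [u] is judged under the same measure [mu]. *)
Definition sign_error (S : 'I_m -> set (n.-tuple R)) (u : {ffun 'I_m -> bool})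
    (j : 'I_m) : set (n.-tuple R) :=
  [set z | (tshift (signal u) z \in S j) != u j].

Let flip (j : 'I_m) (u : {ffun 'I_m -> bool}) : {ffun 'I_m -> bool} :=
  [ffun k => if k == j then ~~ u k else u k].

Let flipK j : involutive (flip j).
Proof. by move=> u; apply/ffunP => k; rewrite !ffunE; case: (k == j); rewrite ?negbK. Qed.

Lemma measurable_sign_error S u j : (forall j, measurable (S j)) ->
  measurable (sign_error S u j).
Proof.
move=> mS; have mSu : measurable (tshift (signal u) @^-1` S j).
  by rewrite -[X in measurable X]setTI; exact: measurable_tshift.
rewrite /sign_error; case: (u j).
  rewrite (_ : [set _ | _] = ~` (tshift (signal u) @^-1` S j)); first exact: measurableC.
  by apply/seteqP; split=> z /=; rewrite eqb_id notin_setE.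
rewrite (_ : [set _ | _] = tshift (signal u) @^-1` S j)//.
by apply/seteqP; split=> z /=; rewrite eqbF_neg negbK in_setE.
Qed.

(** The squared norm, in units of the noise level, of the shift caused by flipping sign [j]. *)
Let tj (j : 'I_m) : R := \sum_(i < n) (if rho i == j then 4 * delta ^+ 2 / s ^+ 2 else 0).

(** Each observation contributes to exactly one index, so the total does not depend on [rho]. *)
Let sum_tj : \sum_(j < m) tj j = n%:R * (4 * delta ^+ 2 / s ^+ 2).
Proof.
rewrite exchange_big/= (eq_bigr (fun=> 4 * delta ^+ 2 / s ^+ 2)).
  by rewrite sumr_const card_ord [RHS]mulr_natl.
move=> i _; rewrite (bigD1 (rho i))//= eqxx big1 ?addr0// => j.
by rewrite eq_sym => /negbTE ->.
Qed.

(** The two probabilities are the two kinds of error of one test between noise laws that differ by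
    the shift [h], to which [test_error_ge] applies. *)
Let flip_error S u j : (forall j, measurable (S j)) ->
  3 / 4 - tj j <= fine (mu (sign_error S u j)) + fine (mu (sign_error S (flip j u) j)).
Proof.
move=> mS; wlog uj : u / u j => [H|].
  have [uj|uj] := boolP (u j); first exact: H.
  have /H : flip j u j by rewrite ffunE eqxx.
  by rewrite flipK [leRHS]addrC.
(* With [u j] true, the flip moves the signal from [delta] to [- delta] on the observations of index
   [j]. *)
pose h i := if rho i == j then - delta *+ 2 else 0.
pose B := tshift (signal u) @^-1` S j.
have mB : measurable B by rewrite -[X in measurable X]setTI; exact: measurable_tshift.
have -> : tj j = \sum_(i < n) h i ^+ 2 / s ^+ 2.
  apply: eq_bigr => i _; rewrite /h; case: ifP => _; last by rewrite expr0n/= mul0r.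
  by congr (_ / _); ring.
have -> : sign_error S u j = ~` B.
  by apply/seteqP; split=> z; rewrite /sign_error/= uj eqb_id notin_setE.
have -> : sign_error S (flip j u) j = tshift h @^-1` B.
  have sE z : tshift (signal u) (tshift h z) = tshift (signal (flip j u)) z.
    rewrite tshiftD; congr tshift; apply/funext => i; rewrite /h /signal ffunE.
    case: eqP => [->|_]; last by rewrite add0r.
    by rewrite uj/= mulr2n addrNK.
  apply/seteqP; split=> z; rewrite /sign_error/B/= sE ffunE eqxx uj/=;
    by rewrite eqbF_neg negbK in_setE.
exact: (test_error_ge s0 nuE mu_rect).
Qed.

(** Pairing each [u] with its flip at [j] counts every [u] twice, hence the division by 2. The
    hypothesis on [delta] bounds the sum of the [tj] by m/4, and (3/4 - 1/4) / 2 = 1/4. *)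
Lemma sum_sign_error_ge S : (forall j, measurable (S j)) ->
  16 * delta ^+ 2 * n%:R <= s ^+ 2 * m%:R ->
  2 ^+ m * m%:R / 4 <=
  \sum_(u : {ffun 'I_m -> bool}) \sum_(j < m) fine (mu (sign_error S u j)).
Proof.
move=> mS hd; rewrite exchange_big/=.
have s2 : 0 < s ^+ 2 by rewrite exprn_even_gt0.
have cardu : #|{ffun 'I_m -> bool}| = (2 ^ m)%N.
  by rewrite card_ffun card_bool card_ord.
have Hj j : 2 ^+ m * (3 / 4 - tj j) / 2 <= \sum_u fine (mu (sign_error S u j)).
  rewrite ler_pdivrMr// mulr_natr mulr2n.
  rewrite [X in _ <= _ + X](reindex_inj (inv_inj (flipK j)))/= -big_split/=.
  apply: (@le_trans _ _ (\sum_(u : {ffun 'I_m -> bool}) (3 / 4 - tj j))).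
    by rewrite sumr_const cardu -[leRHS]mulr_natl natrX.
  by apply: ler_sum => u _; exact: flip_error.
apply: (@le_trans _ _ (\sum_(j < m) 2 ^+ m * (3 / 4 - tj j) / 2)); last first.
  by apply: ler_sum => j _; exact: Hj.
rewrite -mulr_suml -mulr_sumr sumrB sum_tj sumr_const card_ord -[X in X - _]mulr_natl.
have : n%:R * (4 * delta ^+ 2 / s ^+ 2) <= m%:R / 4.
  rewrite mulrA ler_pdivrMr//; lra.
have p2 : 0 < 2 ^+ m :> R by rewrite exprn_gt0.
nra.
Qed.

(** The number of sign errors is at most m/8 outside [E u] and at most m on it. Integrating this and
    comparing with the mean m/4 leaves an average probability of at least 1/8. *)
Lemma assouad_prob S (E : {ffun 'I_m -> bool} -> set (n.-tuple R)) :
  (0 < m)%N -> (forall j, measurable (S j)) -> (forall u, measurable (E u)) ->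
  16 * delta ^+ 2 * n%:R <= s ^+ 2 * m%:R ->
  (forall u z, (m < 8 * #|[pred j | (tshift (signal u) z \in S j) != u j]|)%N -> E u z) ->
  2 ^+ m / 8 <= \sum_(u : {ffun 'I_m -> bool}) fine (mu (E u)).
Proof.
move=> m0 mS mE hd SE.
have H u : \sum_(j < m) fine (mu (sign_error S u j)) <= m%:R / 8 + m%:R * fine (mu (E u)).
  have mu_fin A : measurable A -> (fine (mu A))%:E = mu A.
    by move=> mA; rewrite fineK// fin_num_measure.
  have muE A : measurable A -> mu A = (\int[mu]_y (\1_A y)%:E)%E.
    by move=> mA; rewrite integral_indic// setIT.
  have mse j : measurable (sign_error S u j) by exact: measurable_sign_error.
  rewrite -lee_fin EFinD [X in (_ + X)%E]EFinM mu_fin// -sumEFin.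
  under eq_bigr do rewrite mu_fin// muE//.
  rewrite -ge0_integral_sum//; last first.
    by move=> j; apply/measurable_EFinP; exact: measurable_indic.
  rewrite (muE (E u))// -ge0_integralZl_EFin//; last first.
    by apply/measurable_EFinP; exact: measurable_indic.
  have -> : (m%:R / 8)%:E = (\int[mu]_y (m%:R / 8)%:E)%E.
    rewrite (integral_cst mu measurableT) -[LHS]mule1; congr (_ * _)%E.
    exact/esym/probability_setT.
  rewrite -ge0_integralD//; last first.
    apply: emeasurable_funM => //.
    by apply/measurable_EFinP; exact: measurable_indic.
  apply: ge0_le_integral => //.
  - by move=> y _; apply: sume_ge0.
  - apply: emeasurable_sum => j.
    by apply/measurable_EFinP; exact: measurable_indic.
  - apply: emeasurable_funD => //; apply: emeasurable_funM => //.
    by apply/measurable_EFinP; exact: measurable_indic.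
  move=> y _; rewrite sumEFin -EFinM -EFinD lee_fin.
  rewrite [leLHS](_ : _ =
      #|[pred j | (tshift (signal u) y \in S j) != u j]|%:R); last first.
    rewrite -sum1_card natr_sum [RHS]big_mkcond/=; apply: eq_bigr => j _.
    have yE : (y \in sign_error S u j) = ((tshift (signal u) y \in S j) != u j).
      by apply/idP/idP => [/set_mem//|]; exact: mem_set.
    by rewrite indicE yE inE; case: (_ != _).
  set k := #|_|.
  have km : (k <= m)%N by rewrite -[X in (_ <= X)%N]card_ord max_card.
  have [mk|mk] := ltnP m (8 * k).
    rewrite indicE mem_set; last exact: SE.
    by rewrite mulr1 -[leLHS]add0r lerD ?divr_ge0// ler_nat.
  rewrite -[leLHS]addr0 lerD ?mulr_ge0//.
  by rewrite ler_pdivlMr// -natrM ler_nat mulnC.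
have H1 : \sum_u \sum_(j < m) fine (mu (sign_error S u j)) <=
    \sum_u (m%:R / 8 + m%:R * fine (mu (E u))).
  by apply: ler_sum => u _; exact: H.
have := le_trans (sum_sign_error_ge mS hd) H1.
rewrite big_split/= sumr_const -mulr_sumr card_ffun card_bool card_ord.
rewrite -[X in X + _]mulr_natl natrX.
have mR : 0 < m%:R :> R by rewrite ltr0n.
nra.
Qed.

End assouad.

(** * The spectral norm *)

(** Lagrange's identity writes twice the difference of the two sides as a sum of squares. *)
Lemma cauchy_schwarz_sum (R : realFieldType) (I : finType) (f g : I -> R) :
  (\sum_i f i * g i) ^+ 2 <= (\sum_i f i ^+ 2) * (\sum_i g i ^+ 2).
Proof.
have : 0 <= \sum_i \sum_j (f i * g j - f j * g i) ^+ 2.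
  by apply: sumr_ge0 => i _; apply: sumr_ge0 => j _; exact: sqr_ge0.
have -> : \sum_i \sum_j (f i * g j - f j * g i) ^+ 2 =
    (\sum_i f i ^+ 2) * (\sum_i g i ^+ 2) *+ 2 - (\sum_i f i * g i) ^+ 2 *+ 2.
  have prodE (a b : I -> R) : (\sum_i a i) * (\sum_i b i) = \sum_i \sum_j a i * b j.
    by rewrite mulr_suml; apply: eq_bigr => i _; rewrite mulr_sumr.
  rewrite mulr2n {2}[_ * (\sum_i g i ^+ 2)]mulrC expr2 !prodE -mulNrn -sumrN.
  rewrite -sumrMnl -!big_split/=; apply: eq_bigr => i _.
  rewrite -sumrN -sumrMnl -!big_split/=; apply: eq_bigr => j _; ring.
by lra.
Qed.

Section norms.
Context {R : realType}.

Lemma mxdotE m n (A B : 'M[R]_(m, n)) :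
  mxdot A B = \sum_j \sum_i A i j * B i j.
Proof.
rewrite /mxdot /mxtrace; apply: eq_bigr => j _; rewrite mxE.
by apply: eq_bigr => i _; rewrite mxE.
Qed.

Lemma frob_norm_ge0 m n (A : 'M[R]_(m, n)) : 0 <= frob_norm A.
Proof. exact: sqrtr_ge0. Qed.

Lemma frob_norm_cVE m (x : 'cV[R]_m) : frob_norm x = Num.sqrt (\sum_i x i 0 ^+ 2).
Proof. by rewrite /frob_norm mxdotE big_ord1; congr Num.sqrt. Qed.

Lemma sqr_frob_norm_cV m (x : 'cV[R]_m) : frob_norm x ^+ 2 = \sum_i x i 0 ^+ 2.
Proof. by rewrite frob_norm_cVE sqr_sqrtr// sumr_ge0// => i _; exact: sqr_ge0. Qed.

Lemma frob_normZ m (c : R) (x : 'cV[R]_m) :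
  0 <= c -> frob_norm (c *: x) = c * frob_norm x.
Proof.
move=> c0; apply/eqP; rewrite -(@eqrXn2 _ 2) ?mulr_ge0 ?frob_norm_ge0//.
rewrite exprMn !sqr_frob_norm_cV mulr_sumr; apply/eqP.
by apply: eq_bigr => i _; rewrite mxE exprMn.
Qed.

(** Cauchy-Schwarz on each row bounds the set by the Frobenius norm, so that [sup] is a genuine
    upper bound. *)
Lemma has_ubound_spectral m n (C : 'M[R]_(m, n)) :
  has_ubound [set frob_norm (C *m x) | x in [set x : 'cV[R]_n | frob_norm x = 1]].
Proof.
exists (Num.sqrt (\sum_i \sum_k C i k ^+ 2)) => _ [x /= x1 <-].
rewrite frob_norm_cVE ler_sqrt; last first.
  by apply: sumr_ge0 => i _; apply: sumr_ge0 => k _; exact: sqr_ge0.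
apply: ler_sum => i _; rewrite mxE.
apply: (le_trans (cauchy_schwarz_sum _ _)).
by rewrite -sqr_frob_norm_cV x1 expr1n mulr1.
Qed.

Lemma frob_norm_mul_le m n (C : 'M[R]_(m, n)) (x : 'cV[R]_n) :
  frob_norm (C *m x) <= spectral_norm C * frob_norm x.
Proof.
have [x0|x0] := eqVneq (frob_norm x) 0.
  have -> : x = 0.
    apply/matrixP => i j; rewrite ord1 mxE; apply/eqP; rewrite -sqrf_eq0.
    have xx0 : \sum_i x i 0 ^+ 2 = 0 by rewrite -sqr_frob_norm_cV x0 expr0n.
    by rewrite (psumr_eq0P _ xx0)// => k _; exact: sqr_ge0.
  rewrite mulmx0 frob_norm_cVE big1 ?sqrtr0; last by move=> i _; rewrite mxE expr0n.
  by rewrite frob_norm_cVE big1 ?sqrtr0 ?mulr0// => i _; rewrite mxE expr0n.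
have xgt0 : 0 < frob_norm x by rewrite lt_def x0 frob_norm_ge0.
rewrite -ler_pdivrMr// mulrC -frob_normZ ?invr_ge0 ?frob_norm_ge0// scalemxAr.
apply: (ub_le_sup (has_ubound_spectral C)).
exists ((frob_norm x)^-1 *: x) => //=.
by rewrite frob_normZ ?invr_ge0 ?frob_norm_ge0// mulVf.
Qed.

Lemma spectral_norm_ge0 m n (C : 'M[R]_(m, n)) : 0 <= spectral_norm C.
Proof.
rewrite /spectral_norm; set E := [set _ | _ in _].
(* Without columns there is no unit vector, and [sup] takes its default value 0. *)
have [->|/set0P[y Ey]] := eqVneq E set0; first by rewrite sup0.
apply: le_trans (ub_le_sup (has_ubound_spectral C) Ey).
by case: Ey => x _ <-; exact: frob_norm_ge0.
Qed.

(** Row sums are the entries of [C] applied to the all-ones vector, whose squared norm is [n]. *)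
Lemma spectral_norm_rows m n (C : 'M[R]_(m, n)) :
  \sum_i (\sum_k C i k) ^+ 2 <= n%:R * spectral_norm C ^+ 2.
Proof.
have := frob_norm_mul_le C (const_mx 1).
rewrite -ler_sqr ?nnegrE ?mulr_ge0 ?frob_norm_ge0 ?spectral_norm_ge0//.
rewrite exprMn !sqr_frob_norm_cV mulrC => H.
apply: le_trans (le_trans H _).
  apply: ler_sum => i _; rewrite mxE.
  by under [X in _ <= X ^+ 2]eq_bigr do rewrite mxE mulr1.
rewrite (eq_bigr (fun=> 1)) ?sumr_const ?card_ord// => i _.
by rewrite mxE expr1n.
Qed.

(** No norm of a transpose is involved: for the vector [x] of column sums, |x|^2 is the inner
    product of the all-ones vector with [C *m x], so Cauchy-Schwarz bounds |x|^4, and |x|^2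
    cancels. *)
Lemma spectral_norm_cols m n (C : 'M[R]_(m, n)) :
  \sum_k (\sum_i C i k) ^+ 2 <= m%:R * spectral_norm C ^+ 2.
Proof.
pose x : 'cV[R]_n := \col_k \sum_i C i k.
have xE : \sum_k (\sum_i C i k) ^+ 2 = frob_norm x ^+ 2.
  by rewrite sqr_frob_norm_cV; apply: eq_bigr => k _; rewrite mxE.
have : (frob_norm x ^+ 2) ^+ 2 <= m%:R * (spectral_norm C * frob_norm x) ^+ 2.
  have -> : frob_norm x ^+ 2 = \sum_i 1 * (C *m x) i 0.
    rewrite sqr_frob_norm_cV.
    under [RHS]eq_bigr do rewrite mul1r mxE.
    rewrite exchange_big/=; apply: eq_bigr => k _.
    by rewrite -mulr_suml expr2 mxE.
  apply: (le_trans (cauchy_schwarz_sum _ _)).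
  rewrite (eq_bigr (fun=> 1)) ?sumr_const ?card_ord//; last by move=> i _; rewrite expr1n.
  rewrite -sqr_frob_norm_cV ler_wpM2l// ler_sqr ?nnegrE ?mulr_ge0
    ?frob_norm_ge0 ?spectral_norm_ge0//.
  exact: frob_norm_mul_le.
rewrite xE (exprMn 2 (spectral_norm C)) mulrA.
move: (frob_norm x ^+ 2) (sqr_ge0 (frob_norm x)) => y.
rewrite le_eqVlt => /orP[/eqP <- _|y0]; first by rewrite mulr_ge0 ?sqr_ge0.
by rewrite expr2 ler_pM2r.
Qed.

End norms.

(** * Borel measurability of matrix functionals *)

Section matrix_measurability.
Context {R : realType} (m n : nat).

Lemma continuous_sumr (T : topologicalType) (I : Type) (r : seq I) (F : I -> T -> R) :
  (forall i, continuous (F i)) -> continuous (fun x => \sum_(i <- r) F i x).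
Proof.
by move=> cF; apply: continuous_big => [|i _]; [exact: add_continuous|exact: cF].
Qed.

Lemma measurable_open_mx (U : set 'M[R]_(m, n)) : open U -> measurable U.
Proof. by move=> oU; exact: sub_sigma_algebra. Qed.

Lemma measurable_mx_coord i j : measurable_fun setT (fun A : 'M[R]_(m, n) => A i j).
Proof.
apply: (measurability _ (RGenOpens.measurableE R)).
move=> _ [_ [a [b ->] <-]]; rewrite setTI; apply: measurable_open_mx.
by apply: open_comp; [move=> ? _; exact: coord_continuous|exact: interval_open].
Qed.

Lemma measurable_mxdot d (T : measurableType d) (f : T -> 'M[R]_(m, n)) A :
  measurable_fun setT f -> measurable_fun setT (fun t => mxdot (f t) A).
Proof.
move=> mf; under eq_fun do rewrite mxdotE.
apply: measurable_sum => j; apply: measurable_sum => i.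
apply: measurable_funM => //.
by apply: (measurableT_comp (measurable_mx_coord i j)).
Qed.

(** A supremum of continuous functions is lower semicontinuous: the set is a union, over unit
    vectors, of open sets. *)
Lemma open_spectral_norm_gt (t : R) (A0 : 'M[R]_(m, n)) : (0 < n)%N ->
  open [set A | t < spectral_norm (A - A0)].
Proof.
move=> n0.
have -> : [set A | t < spectral_norm (A - A0)] =
    \bigcup_(x in [set x : 'cV[R]_n | frob_norm x = 1])
      [set A | t < frob_norm ((A - A0) *m x)].
  apply/seteqP; split=> [A /= tA|A [x /= x1 tx]]; last first.
    by apply: (lt_le_trans tx); rewrite -[leRHS]mulr1 -x1; exact: frob_norm_mul_le.
  have [|_ [x /= x1 <-] tx] := sup_gt _ tA; last by exists x.
  (* A basis vector shows that the supremum is over a nonempty set, as [sup_gt] requires. *)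
  pose x : 'cV[R]_n := delta_mx (Ordinal n0) 0.
  exists (frob_norm ((A - A0) *m x)); exists x => //=.
  rewrite frob_norm_cVE (bigD1 (Ordinal n0))//= mxE !eqxx expr1n big1 ?addr0 ?sqrtr1//.
  by move=> i /negbTE i0; rewrite mxE i0 expr0n.
apply: bigcup_open => x _.
have cf : continuous (fun A : 'M[R]_(m, n) => frob_norm ((A - A0) *m x)).
  have -> : (fun A : 'M[R]_(m, n) => frob_norm ((A - A0) *m x)) =
      (fun A => Num.sqrt (\sum_i (\sum_k (A i k - A0 i k) * x k 0) ^+ 2)).
    apply/funext => A; rewrite frob_norm_cVE; congr Num.sqrt.
    apply: eq_bigr => i _; rewrite mxE; congr (_ ^+ 2).
    by apply: eq_bigr => k _; rewrite !mxE.
  move=> A; apply: continuous_comp; last exact: sqrt_continuous.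
  apply: continuous_sumr => i {}A.
  apply: (@continuous_comp _ _ _ _ (fun y : R => y ^+ 2)); last exact: exprn_continuous.
  apply: continuous_sumr => k {}A.
  apply: (@continuousM _ _ (fun A : 'M[R]_(m, n) => A i k - A0 i k) (fun=> x k 0)).
    apply: (@continuousB _ _ _ (fun A : 'M[R]_(m, n) => A i k) (fun=> A0 i k)).
      exact: coord_continuous.
    exact: cst_continuous.
  exact: cst_continuous.
apply: (@open_comp _ _ (fun A : 'M[R]_(m, n) => frob_norm ((A - A0) *m x))
  [set y | t < y]).
  by move=> A _; exact: cf.
exact: open_gt.
Qed.

End matrix_measurability.

(** * Conditioning on the design *)

Lemma measure_bigcup_finType d (T : measurableType d) (R : realType)
    (mu : {measure set T -> \bar R}) (I : finType) (F : I -> set T) :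
  trivIset setT F -> (forall i, measurable (F i)) ->
  (mu (\bigcup_(i in [set: I]) F i) = \sum_i mu (F i))%E.
Proof.
have fI : finite_set [set: I] by exact: finite_finset.
move=> tF mF; rewrite measure_fin_bigcup// fsbig_finite//=.
apply: perm_big; apply: uniq_perm; [exact: finmap.fset_uniq|exact: index_enum_uniq|].
by move=> i; rewrite in_fset_set// mem_index_enum in_setT.
Qed.

Section regression.
Context {R : realType} {d : measure_display} {Omega : measurableType d}.
Variables (P : probability Omega R) (m1 m2 n : nat).
Variables (X : 'I_n -> {RV P >-> 'M[R]_(m1, m2)}) (xi : 'I_n -> {RV P >-> R}).

Lemma measurable_vec d' (T : measurableType d') (Y : 'I_n -> Omega -> T) :
  (forall i, measurable_fun setT (Y i)) -> measurable_fun setT (vec Y).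
Proof.
move=> mY; apply/measurable_fun_tnthP => i; apply: eq_measurable_fun (mY i) => w _.
by rewrite /= tnth_mktuple.
Qed.

Lemma measurable_observations A : measurable_fun setT (observations X xi A).
Proof.
apply: measurable_vec => i; apply: measurable_fun_pair => //.
by apply: measurable_funD => //; exact: measurable_mxdot.
Qed.

Lemma measurable_mx_set1 (A : 'M[R]_(m1, m2)) : measurable [set A].
Proof.
have -> : [set A] = \bigcap_(i in [set: 'I_m1]) \bigcap_(j in [set: 'I_m2])
    ((fun B : 'M[R]_(m1, m2) => B i j) @^-1` [set A i j]).
  apply/seteqP; split=> [_ -> //|B AB]; apply/matrixP => i j; exact: AB.
apply: fin_bigcap_measurable => // i _; apply: fin_bigcap_measurable => // j _.
by rewrite -[X in measurable X]setTI; apply: measurable_mx_coord.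
Qed.

Lemma delta_mxE j k : basis_vec j *m (basis_vec k)^T = delta_mx j k :> 'M[R]_(m1, m2).
Proof. by rewrite /basis_vec trmx_delta mul_delta_mx. Qed.

Lemma mxdot_delta j k (A : 'M[R]_(m1, m2)) : mxdot (delta_mx j k) A = A j k.
Proof.
rewrite mxdotE (bigD1 k)//= (bigD1 j)//= mxE !eqxx mul1r !big1 ?addr0//.
  by move=> l lk; rewrite big1// => i _; rewrite mxE (negbTE lk) andbF mul0r.
by move=> i ij; rewrite mxE (negbTE ij) mul0r.
Qed.

Lemma measurable_basis_mxs : measurable (@basis_mxs R m1 m2).
Proof.
have -> : @basis_mxs R m1 m2 =
    \bigcup_(c in [set: 'I_m1 * 'I_m2]) [set delta_mx c.1 c.2].
  apply/seteqP; split=> [A [j [k ->]]|A [[j k] _ ->]].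
    by exists (j, k) => //=; rewrite delta_mxE.
  by exists j, k; rewrite delta_mxE.
by apply: fin_bigcup_measurable => // c _; exact: measurable_mx_set1.
Qed.

Lemma delta_mx_inj (j j' : 'I_m1) (k k' : 'I_m2) :
  delta_mx j k = delta_mx j' k' :> 'M[R]_(m1, m2) -> (j, k) = (j', k').
Proof.
move/matrixP/(_ j k); rewrite !mxE !eqxx/=.
by have [->|_] := eqVneq j j'; have [->|_] := eqVneq k k' => //= /eqP; rewrite oner_eq0.
Qed.

(** The map [p] selects the sign used by an entry; the two projections give constant rows and
    constant columns, so that one argument covers both shapes. *)
Definition sign_mx m (p : 'I_m1 -> 'I_m2 -> 'I_m) (delta : R)
    (u : {ffun 'I_m -> bool}) : 'M[R]_(m1, m2) :=
  \matrix_(j, k) (if u (p j k) then delta else - delta).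

Variables (sigma : R) (Pi : probability 'M[R]_(m1, m2) R).
Hypotheses (n0 : (0 < n)%N) (m20 : (0 < m2)%N) (sigma0 : 0 < sigma).
Hypothesis Pi1 : Pi (@basis_mxs R m1 m2) = 1%E.
Hypothesis lawX : forall i, has_law P (X i) Pi.
Hypothesis indX : mutually_independent P X.
Hypothesis lawxi : forall i, has_law P (xi i) (normal_prob 0 sigma).
Hypothesis indxi : mutually_independent P xi.
Hypothesis indXxi : independent P (vec X) (vec xi).

Let design := {ffun 'I_n -> 'I_m1 * 'I_m2}.

Let dpt (x : design) (i : 'I_n) : 'M[R]_(m1, m2) := delta_mx (x i).1 (x i).2.

(** Conditioning on the design becomes a finite partition up to a null set. Writing a cell as a
    preimage under [vec X] lets independence from [vec xi] apply to it. *)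
Let cell (x : design) : set Omega :=
  vec X @^-1` [set y | forall i, [set dpt x i] (tnth y i)].

Let mcell x : measurable (cell x).
Proof.
have mX : measurable_fun setT (vec X) by apply: measurable_vec => i.
rewrite -[X in measurable X]setTI; apply: mX => //.
apply: (@measurable_rectangle _ _ _ (fun i => [set dpt x i])) => i.
exact: measurable_mx_set1.
Qed.

Let cellP x w : cell x w <-> forall i, X i w = dpt x i.
Proof. by split=> [xw i|xw i]; have := xw i; rewrite tnth_mktuple. Qed.

Let tcell : trivIset setT cell.
Proof.
move=> x y _ _ [w [/cellP xw /cellP yw]]; apply/ffunP => i.
have := xw i; rewrite yw => /delta_mx_inj.
by case: (x i) (y i) => [? ?] [? ?].
Qed.

Let sum_cell : (\sum_x P (cell x) = 1)%E.
Proof.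
transitivity (P (\bigcup_(x in [set: design]) cell x)).
  by rewrite measure_bigcup_finType.
rewrite (_ : \bigcup_(_ in _) _ = [set w | forall i, @basis_mxs R m1 m2 (X i w)]).
  rewrite (indX (fun=> measurable_basis_mxs)) big1// => i _.
  have := lawX i measurable_basis_mxs.
  by rewrite Pi1.
apply/seteqP; split=> [w [x _ /cellP xw] i|w Xw].
  by exists (x i).1, (x i).2; rewrite delta_mxE xw.
have /choice[x xw] i : exists c : 'I_m1 * 'I_m2, X i w = delta_mx c.1 c.2.
  by have [j [k jk]] := Xw i; exists (j, k); rewrite jk delta_mxE.
by exists (finfun x) => //; apply/cellP => i; rewrite /dpt ffunE.
Qed.

Let i0 : 'I_n := Ordinal n0.
Let nu : probability R R := distribution P (xi i0).

Let mxi : measurable_fun setT (vec xi).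
Proof. exact: measurable_vec. Qed.

Let Vxi : {mfun Omega >-> n.-tuple R} :=
  HB.pack (vec xi : Omega -> n.-tuple R) (isMeasurableFun.Build _ _ _ _ _ mxi).

Let mu : probability (n.-tuple R) R := distribution P Vxi.

Let nuE B : measurable B -> nu B = normal_prob 0 sigma B.
Proof. by move=> mB; exact: (lawxi i0). Qed.

Let mu_rect (A : 'I_n -> set R) : (forall i, measurable (A i)) ->
  mu [set y | forall i, A i (tnth y i)] = (\prod_(i < n) nu (A i))%E.
Proof.
move=> mA; transitivity (P [set w | forall i, A i (xi i w)]).
  congr (P _); apply/seteqP; split=> w /= wA i; have := wA i;
    by rewrite tnth_mktuple.
rewrite indxi//; apply: eq_bigr => i _; rewrite nuE//.
by rewrite -(lawxi i).
Qed.

(** On each cell the data are a fixed function of the noise, so [assouad_prob] applies there.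
    Averaging over cells and then over the 2^m sign vectors yields a [u] with probability at least
    1/8. The sign of [f j] is the test for [u j]. *)
Lemma exists_sign_mx_large_risk m (p : 'I_m1 -> 'I_m2 -> 'I_m)
    (f : 'I_m -> 'M[R]_(m1, m2) -> R) (delta t : R)
    (Ahat : {mfun n.-tuple ('M[R]_(m1, m2) * R)%type >-> 'M[R]_(m1, m2)}) :
  (0 < m)%N -> (forall j, measurable_fun setT (f j)) ->
  16 * delta ^+ 2 * n%:R <= sigma ^+ 2 * m%:R ->
  (forall (u : {ffun 'I_m -> bool}) B, (m < 8 * #|[pred j | (0 < f j B)%R != u j]|)%N ->
     t < spectral_norm (B - sign_mx p delta u)) ->
  exists u, (8^-1%:E <= obs_law P X xi (sign_mx p delta u)
    [set D | (t < spectral_norm (Ahat D - sign_mx p delta u))%R])%E.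
Proof.
move=> m0 mf hd spec.
pose A u := sign_mx p delta u.
pose D u := [set D | t < spectral_norm (Ahat D - A u)].
have mAhat B : measurable B -> measurable (Ahat @^-1` B).
  by move=> mB; rewrite -[X in measurable X]setTI; exact: (measurable_funP Ahat).
have mD u : measurable (D u).
  exact: (mAhat _ (measurable_open_mx (@open_spectral_norm_gt _ _ _ t (A u) m20))).
pose Ev u := observations X xi (A u) @^-1` D u.
have mEv u : measurable (Ev u).
  by rewrite -[X in measurable X]setTI; exact: measurable_observations.
pose data (x : design) (y : n.-tuple R) : n.-tuple ('M[R]_(m1, m2) * R)%type :=
  [tuple (dpt x i, tnth y i) | i < n].
have mdata x : measurable_fun setT (data x).
  apply/measurable_fun_tnthP => i.
  apply: (eq_measurable_fun (fun y : n.-tuple R => (dpt x i, tnth y i))).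
    by move=> y _; rewrite /= tnth_mktuple.
  by apply: measurable_fun_pair => //; exact: measurable_tnth.
pose rho (x : design) i := p (x i).1 (x i).2.
pose S x j := data x @^-1` (Ahat @^-1` [set B | 0 < f j B]).
have mS x j : measurable (S x j).
  have mfj : measurable [set B | 0 < f j B].
    rewrite (_ : [set _ | _] = f j @^-1` `]0, +oo[%classic); last first.
      by apply/seteqP; split=> B; rewrite /= in_itv/= andbT.
    by rewrite -[X in measurable X]setTI; exact: mf.
  by rewrite -[X in measurable X]setTI; apply: mdata => //; exact: mAhat.
pose E x u := tshift (signal (rho x) delta u) @^-1` (data x @^-1` D u).
have mE x u : measurable (E x u).
  rewrite -[X in measurable X]setTI; apply: measurable_tshift => //.
  by rewrite -[X in measurable X]setTI; exact: mdata.
have risk x : 2 ^+ m / 8 <= \sum_u fine (mu (E x u)).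
  apply: (assouad_prob (rho := rho x) (lt0r_neq0 sigma0) nuE mu_rect m0 (mS x) (mE x) hd).
  move=> u z err; apply: spec; apply: (leq_trans err).
  rewrite leq_mul2l/=; apply: subset_leq_card; apply/fintype.subsetP => j.
  rewrite !inE; set y := tshift _ z.
  have -> // : (y \in S x j) = (0 < f j (Ahat (data x y))).
  by apply/idP/idP => [/set_mem|?]; last exact: mem_set.
have obsE u x w : cell x w ->
    observations X xi (A u) w = data x (tshift (signal (rho x) delta u) (vec xi w)).
  move=> /cellP xw; apply: eq_from_tnth => i; rewrite !tnth_mktuple xw.
  by rewrite mxdot_delta mxE addrC.
have EvE u x : P (Ev u `&` cell x) = (P (cell x) * mu (E x u))%E.
  have mR : measurable [set y : n.-tuple 'M[R]_(m1, m2) |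
      forall i, [set dpt x i] (tnth y i)].
    apply: (@measurable_rectangle _ _ _ (fun i => [set dpt x i])) => i.
    exact: measurable_mx_set1.
  rewrite -(indXxi mR (mE x u)); congr (P _).
  apply/seteqP; split=> w [] => [uw xw|xw].
    by split=> //; rewrite /E /preimage/= -(obsE _ _ _ xw).
  by rewrite /E /preimage/= -(obsE _ _ _ xw).
have fP x : P (cell x) \is a fin_num by exact: fin_num_measure.
(* Cells are disjoint, so their traces on [Ev u] add up to at most its probability. *)
have EvS u : \sum_x fine (P (cell x)) * fine (mu (E x u)) <= fine (P (Ev u)).
  rewrite -lee_fin fineK ?fin_num_measure// -sumEFin.
  under eq_bigr do rewrite EFinM !fineK ?fin_num_measure// -EvE.
  apply: (@le_trans _ _ (P (\bigcup_(x in [set: design]) (Ev u `&` cell x)))).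
    rewrite measure_bigcup_finType//; first exact: trivIset_setIl.
    by move=> x; exact: measurableI.
  apply: le_measure; last by move=> w [x _ []].
    apply/mem_set; apply: fin_bigcup_measurable => [|x _]; first exact: finite_finset.
    exact: measurableI.
  exact/mem_set.
have total : 2 ^+ m / 8 <= \sum_u fine (P (Ev u)).
  apply: (@le_trans _ _ (\sum_u \sum_x fine (P (cell x)) * fine (mu (E x u)))).
    rewrite exchange_big/=.
    apply: (@le_trans _ _ (\sum_x fine (P (cell x)) * (2 ^+ m / 8))).
      rewrite -mulr_suml.
      suff -> : \sum_x fine (P (cell x)) = 1 by rewrite mul1r.
      apply: EFin_inj; rewrite -sumEFin -sum_cell.
      by apply: eq_bigr => x _; rewrite fineK.
    apply: ler_sum => x _; rewrite -mulr_sumr; apply: ler_wpM2l; last exact: risk.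
    by rewrite fine_ge0.
  by apply: ler_sum => u _; exact: EvS.
(* If every [u] had probability below 1/8, the sum over the 2^m sign vectors would be below 2^m /
   8. *)
apply/not_existsP => small.
have := total; apply/negP; rewrite -ltNge.
have -> : 2 ^+ m / 8 = \sum_(u : {ffun 'I_m -> bool}) 8^-1 :> R.
  by rewrite sumr_const card_ffun card_bool card_ord -[RHS]mulr_natl natrX.
apply: ltr_sum => [|u _].
  by apply/hasP; exists [ffun=> true] => //; rewrite mem_index_enum.
rewrite -lte_fin fineK ?fin_num_measure// ltNge; apply/negP; exact: small.
Qed.

End regression.

(** * Separation of sign matrices in spectral norm *)

Lemma sign_error_count (R : realType) (m : nat) (g : 'I_m -> R) (b : R)
    (u : {ffun 'I_m -> bool}) : 0 <= b ->
  #|[pred j | (0 < g j) != u j]|%:R * b ^+ 2 <=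
  \sum_j (g j - (if u j then b else - b)) ^+ 2.
Proof.
move=> b0; rewrite -sum1_card natr_sum mulr_suml big_mkcond/=.
apply: ler_sum => j _; rewrite inE; case: ifPn => [|_]; last exact: sqr_ge0.
(* A wrong sign puts [g j] and its target on opposite sides of zero, hence at distance at least [b];
   the value 0 counts as negative. *)
rewrite mul1r; case: (u j); first by rewrite eqb_id -leNgt; nra.
by rewrite eqbF_neg negbK; nra.
Qed.

Section sign_matrices.
Context {R : realType} (m1 m2 : nat) (delta : R).

Lemma sign_mx_class m (p : 'I_m1 -> 'I_m2 -> 'I_m) r a u :
  (\rank (sign_mx p delta u) <= r)%N -> `|delta| <= a ->
  mx_class r a (sign_mx p delta u).
Proof. by move=> ru da; split=> // i j; rewrite mxE; case: ifP; rewrite ?normrN. Qed.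

Lemma rank_sign_mx_row u :
  (\rank (sign_mx (fun (j : 'I_m1) (_ : 'I_m2) => j) delta u) <= 1)%N.
Proof.
have -> : sign_mx (fun (j : 'I_m1) (_ : 'I_m2) => j) delta u =
    (\col_j (if u j then delta else - delta)) *m (const_mx 1 : 'rV[R]_m2).
  by apply/matrixP => i j; rewrite !mxE big_ord1 !mxE mulr1.
exact: mulmx_max_rank.
Qed.

Lemma rank_sign_mx_col u :
  (\rank (sign_mx (fun (_ : 'I_m1) (k : 'I_m2) => k) delta u) <= 1)%N.
Proof.
have -> : sign_mx (fun (_ : 'I_m1) (k : 'I_m2) => k) delta u =
    (const_mx 1 : 'cV[R]_m1) *m (\row_k (if u k then delta else - delta)).
  by apply/matrixP => i j; rewrite !mxE big_ord1 !mxE mul1r.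
exact: mulmx_max_rank.
Qed.

(** The row sums of the sign matrix are plus or minus [m2 * delta]. Counting sign errors of the row
    sums of [B] and dividing by [m2] in [spectral_norm_rows] gives the bound. *)
Lemma spectral_norm_sub_sign_mx_row (u : {ffun 'I_m1 -> bool})
    (B : 'M[R]_(m1, m2)) : 0 <= delta ->
  #|[pred j | (0 < \sum_k B j k) != u j]|%:R * (m2%:R * delta ^+ 2) <=
  spectral_norm (B - sign_mx (fun j _ => j) delta u) ^+ 2.
Proof.
move=> d0; have [mE|m20] := posnP m2.
  by have -> : m2%:R = 0 :> R by [rewrite mE]; rewrite mul0r mulr0 sqr_ge0.
have mR : 0 < m2%:R :> R by rewrite ltr0n.
rewrite -(ler_pM2l mR); apply: le_trans (spectral_norm_rows _).
have := sign_error_count (fun j => \sum_k B j k) u (mulr_ge0 (ler0n R m2) d0).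
set N := #|_|%:R.
have -> : m2%:R * (N * (m2%:R * delta ^+ 2)) = N * (m2%:R * delta) ^+ 2 by ring.
move=> /le_trans; apply; apply: ler_sum => j _.
rewrite le_eqVlt; apply/orP; left; apply/eqP.
congr (_ ^+ 2); under [RHS]eq_bigr do rewrite !mxE.
by rewrite sumrB sumr_const card_ord; case: (u j); rewrite ?mulNrn mulr_natl.
Qed.

Lemma spectral_norm_sub_sign_mx_col (u : {ffun 'I_m2 -> bool})
    (B : 'M[R]_(m1, m2)) : 0 <= delta ->
  #|[pred k | (0 < \sum_j B j k) != u k]|%:R * (m1%:R * delta ^+ 2) <=
  spectral_norm (B - sign_mx (fun _ k => k) delta u) ^+ 2.
Proof.
move=> d0; have [mE|m10] := posnP m1.
  by have -> : m1%:R = 0 :> R by [rewrite mE]; rewrite mul0r mulr0 sqr_ge0.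
have mR : 0 < m1%:R :> R by rewrite ltr0n.
rewrite -(ler_pM2l mR); apply: le_trans (spectral_norm_cols _).
have := sign_error_count (fun k => \sum_j B j k) u (mulr_ge0 (ler0n R m1) d0).
set N := #|_|%:R.
have -> : m1%:R * (N * (m1%:R * delta ^+ 2)) = N * (m1%:R * delta) ^+ 2 by ring.
move=> /le_trans; apply; apply: ler_sum => j _.
rewrite le_eqVlt; apply/orP; left; apply/eqP.
congr (_ ^+ 2); under [RHS]eq_bigr do rewrite !mxE.
by rewrite sumrB sumr_const card_ord; case: (u j); rewrite ?mulNrn mulr_natl.
Qed.

End sign_matrices.

(** * Choice of constants, and the two shapes of the matrix *)

Theorem theorem3 (R : realType) :
  exists beta c : R, [/\ 0 < beta, beta < 1, 0 < c &
  forall (m1 m2 n r : nat) (a sigma c1 c1' : R)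
    (Pi : probability 'M[R]_(m1, m2) R)
    (d : measure_display) (Omega : measurableType d)
    (P : probability Omega R)
    (X : 'I_n -> {RV P >-> 'M[R]_(m1, m2)})
    (xi : 'I_n -> {RV P >-> R}),
    let M := maxn m1 m2 in
    let m12 : R := m1%:R * m2%:R in
    0 < a -> (1 <= r <= minn m1 m2)%N -> (M * r <= n)%N ->
    Pi (@basis_mxs R m1 m2) = 1%E ->
    0 < c1 -> c1 <= c1' ->
    ((Num.sqrt (c1 / m12))%:E <= kappa1 Pi)%E ->
    (kappa1 Pi <= kappa1' Pi)%E ->
    (kappa1' Pi <= (Num.sqrt (c1' / m12))%:E)%E ->
    (forall i, has_law P (X i) Pi) ->
    mutually_independent P X ->
    0 < sigma ->
    (forall i, has_law P (xi i) (normal_prob 0 sigma)) ->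
    mutually_independent P xi ->
    independent P (vec X) (vec xi) ->
    (beta%:E <=
     ereal_inf [set
       ereal_sup [set
         obs_law P X xi A0
           [set D | (c * Num.min sigma a * Num.sqrt m12
                       * Num.sqrt (M%:R / n%:R) <
                     spectral_norm (Ahat D - A0))%R]
         | A0 in @mx_class R m1 m2 r a]
       | Ahat in [set: {mfun n.-tuple ('M[R]_(m1, m2) * R)%type
                          >-> 'M[R]_(m1, m2)}]])%E].
Proof.
exists 8^-1, 12^-1; split=> //; first by rewrite invf_lt1// ltr1n.
move=> m1 m2 n r a sigma c1 c1' Pi d Omega P X xi M m12 a0 /andP[r0 rm] Mrn Pi1 _ _ _ _ _.
move=> lawX indX sigma0 lawxi indxi indXxi.
have m10 : (0 < m1)%N by rewrite (leq_trans r0)// (leq_trans rm)// geq_minl.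
have m20 : (0 < m2)%N by rewrite (leq_trans r0)// (leq_trans rm)// geq_minr.
have M0 : (0 < M)%N by rewrite (leq_trans m10)// leq_maxl.
have Mn : (M <= n)%N by rewrite (leq_trans _ Mrn)// leq_pmulr.
have n0 : (0 < n)%N by exact: leq_trans M0 Mn.
have nR : 0 < n%:R :> R by rewrite ltr0n.
pose s := Num.min sigma a; pose q : R := Num.sqrt (M%:R / n%:R).
have s0 : 0 < s by rewrite lt_min sigma0.
have q0 : 0 < q by rewrite sqrtr_gt0 divr_gt0// ltr0n.
have q2 : q ^+ 2 = M%:R / n%:R by rewrite sqr_sqrtr// divr_ge0.
have q1 : q <= 1.
  by rewrite -sqrtr1 ler_sqrt// ler_pdivrMr// mul1r ler_nat.
(* The factor 1/4 gives 16 delta^2 n = s^2 M, within the budget of [assouad_prob] as [s <= sigma];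
   [q <= 1] and [s <= a] keep the entries in the class. *)
pose delta := s / 4 * q.
have d0 : 0 < delta by rewrite mulr_gt0// divr_gt0.
have da : `|delta| <= a.
  rewrite gtr0_norm//; have : s <= a by rewrite /s ge_min lexx orbT.
  rewrite /delta; nra.
have hd : 16 * delta ^+ 2 * n%:R <= sigma ^+ 2 * M%:R.
  have -> : 16 * delta ^+ 2 * n%:R = s ^+ 2 * M%:R.
    by rewrite /delta exprMn q2; field; rewrite gt_eqF.
  have ss : s <= sigma by rewrite /s ge_min lexx.
  by apply: ler_wpM2r => //; rewrite ler_sqr// nnegrE ltW.
pose t := 12^-1 * s * Num.sqrt m12 * q.
have m12_0 : 0 <= m12 by rewrite mulr_ge0.
have t0 : 0 <= t by rewrite !mulr_ge0 ?sqrtr_ge0 ?ltW.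
have t2 : t ^+ 2 = m12 * delta ^+ 2 / 9.
  by rewrite /t /delta !exprMn sqr_sqrtr//; field.
(* Here [l] is the smaller dimension. The constant 1/12 makes [t^2] equal to (M/9) l delta^2,
   strictly below k l delta^2 once k > M/8. *)
have tspec k l (B : 'M[R]_(m1, m2)) : (0 < l)%N -> m12 = M%:R * l%:R ->
    (M < 8 * k)%N -> k%:R * (l%:R * delta ^+ 2) <= spectral_norm B ^+ 2 ->
    t < spectral_norm B.
  move=> l0 m12E Mk kB; rewrite -ltr_sqr ?nnegrE ?spectral_norm_ge0//.
  apply: lt_le_trans kB; rewrite t2 m12E.
  have dl : 0 < l%:R * delta ^+ 2 by rewrite mulr_gt0 ?ltr0n ?exprn_gt0.
  rewrite -mulrA -mulrA (mulrA l%:R) [M%:R * _]mulrC -mulrA [X in X < _]mulrC.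
  rewrite (_ : _ * _ = (M%:R / 9) * (l%:R * delta ^+ 2)); last by ring.
  rewrite ltr_pM2r//.
  have : M%:R < 8 * k%:R :> R by rewrite -natrM ltr_nat.
  have : 0 <= k%:R :> R by [].
  lra.
have fcoord (j : 'I_m1) (k : 'I_m2) :
    measurable_fun setT (fun B : 'M[R]_(m1, m2) => B j k).
  exact: measurable_mx_coord.
apply: le_ereal_inf_tmp => _ [Ahat _ <-].
(* The signs are indexed by the longer side: rows when [m2 <= m1], columns otherwise. *)
have [m21|m12'] := leqP m2 m1.
  have ME : M = m1 by exact/maxn_idPl.
  rewrite ME in hd.
  have [||u risk] := @exists_sign_mx_large_risk _ _ _ P m1 m2 n X xi sigma Pi
    n0 m20 sigma0 Pi1 lawX indX lawxi indxi indXxi m1 (fun j _ => j) (fun j B => \sum_k B j k)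
    delta t Ahat m10 _ hd _.
  - by move=> j; apply: measurable_sum => k.
  - move=> u B err.
    apply: (tspec _ _ _ m20 _ _ (spectral_norm_sub_sign_mx_row u B (ltW d0))).
      by rewrite /m12 ME.
    by rewrite ME.
  apply: (le_trans risk); apply: ereal_sup_ubound.
  exists (sign_mx (fun j _ => j) delta u) => //.
  by apply: sign_mx_class => //; apply: leq_trans r0; exact: rank_sign_mx_row.
have ME : M = m2 by exact/maxn_idPr/ltnW.
rewrite ME in hd.
have [||u risk] := @exists_sign_mx_large_risk _ _ _ P m1 m2 n X xi sigma Pi
  n0 m20 sigma0 Pi1 lawX indX lawxi indxi indXxi m2 (fun _ k => k) (fun k B => \sum_j B j k)
  delta t Ahat m20 _ hd _.
- by move=> k; apply: measurable_sum => j.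
- move=> u B err.
  apply: (tspec _ _ _ m10 _ _ (spectral_norm_sub_sign_mx_col u B (ltW d0))).
    by rewrite /m12 ME mulrC.
  by rewrite ME.
apply: (le_trans risk); apply: ereal_sup_ubound.
exists (sign_mx (fun _ k => k) delta u) => //.
by apply: sign_mx_class => //; apply: leq_trans r0; exact: rank_sign_mx_col.
Qed.
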